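(* Let $A\in\mathcal D$ with generic part $A_0$. The action of $\mathcal U_{\mathcal A_0}$ on $\mathcal D_{A_0}$ given by $U\cdot(P,Q)=(UPU^*,UQU^* )$ is transitive.
   Context: Let $\mathcal H$ be a complex Hilbert space, $\mathcal P(\mathcal H)$ the set of orthogonal projections in $\mathcal H$, and $\mathcal D=\{P-Q: P,Q\in\mathcal P(\mathcal H)\}$. For $A\in\mathcal D$ put $\mathcal H_0=(N(A)\oplus N(A^2-1))^\perp$ ($N$ denotes nullspace); this subspace reduces $A$. Let $A_0=A|_{\mathcal H_0}\in\mathcal B(\mathcal H_0)$ (the generic part of $A$) and $\mathcal D_{A_0}=\{(P_0,Q_0)\in\mathcal P(\mathcal H_0)\times\mathcal P(\mathcal H_0): P_0-Q_0=A_0\}$. Let $\mathcal A_0=\{T\in\mathcal B(\mathcal H_0): TA_0=A_0T\}$ and let $\mathcal U_{\mathcal A_0}$ be the group of unitary operators in $\mathcal A_0$. *)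

(* Defs.v *)
From HB Require Import structures.
From mathcomp Require Import all_boot all_order all_algebra.
From mathcomp Require Import sesquilinear complex.
From mathcomp Require Import all_classical all_reals.
From mathcomp Require Import topology normedtype.

Set Implicit Arguments.
Unset Strict Implicit.
Unset Printing Implicit Defensive.

Import Order.TTheory GRing.Theory Num.Theory.
Import numFieldNormedType.Exports.

Local Open Scope classical_set_scope.
Local Open Scope ring_scope.

HB.mixin Record isHilbert (R : realType) H & CompleteNormedModule R[i] H := {
  inner : {dot H for @Num.conj R[i]} ;
  inner_norm : forall x : H, inner x x = `|x| ^+ 2
}.

#[short(type="hilbertType")]
HB.structure Definition Hilbert (R : realType) :=
  {H of CompleteNormedModule R[i] H & isHilbert R H}.

Notation "''[' x , y ]" := (inner x%R y%R) : ring_scope.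

Section InnerTheory.
Context {R : realType} {H : hilbertType R}.
Implicit Types x y z : H.

Lemma innerC x y : '[x, y] = ('[y, x])^*.
Proof. by rewrite hermC expr0 mul1r. Qed.

Lemma CauchySchwarz x y : `|'[x, y]| ^+ 2 <= `|x| ^+ 2 * `|y| ^+ 2.
Proof.
have [->|y0] := eqVneq y 0; first by rewrite linear0r !normr0 expr0n mulr0.
have yy0 : 0 < '[y, y] by rewrite dnorm_gt0.
set c := '[x, y] / '[y, y].
have := dnorm_ge0 inner (x - c *: y).
rewrite dnormB dnormZ linearZr_LR /=.
have cyy : c * '[y, y] = '[x, y] by rewrite /c divfK ?gt_eqF.
have yyr : ('[y, y])^* = '[y, y] by rewrite -innerC.
have -> : c^* * '[x, y] = `|c| ^+ 2 * '[y, y].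
  by rewrite -cyy normCK mulrCA mulrA.
rewrite rmorphM /= yyr.
have -> : (`|c| ^+ 2)^* = `|c| ^+ 2 by rewrite conj_Creal// realX// normr_real.
rewrite addrKA subr_ge0 => h.
rewrite -!inner_norm -[in leLHS]cyy normrM exprMn [`|'[y, y]|]gtr0_norm//.
by rewrite expr2 mulrA ler_pM2r.
Qed.

End InnerTheory.

Definition perp (R : realType) (H : hilbertType R) (S : set H) : set H :=
  [set x | forall y, S y -> '[x, y] = 0].

Definition perpb (R : realType) (H : hilbertType R) (S : set H) : pred H :=
  fun x => x \in perp S.

(* The closed subspace [perp S], as a Hilbert space for the inner product of
   the ambient space. *)
Definition perp_space (R : realType) (H : hilbertType R) (S : set H) : Type :=
  {x : H | perpb S x}.

Section PerpSpace.
Context {R : realType} {H : hilbertType R} (S : set H).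

Lemma perp_submod_closed : submod_closed (perpb S).
Proof.
split=> [|a x y]; rewrite !inE.
  by move=> y _; rewrite linear0l.
by move=> xS yS z Sz; rewrite linearDl linearZl_LR /= xS// yS// mulr0 addr0.
Qed.

HB.instance Definition _ :=
  GRing.isSubmodClosed.Build R[i] H (perpb S) perp_submod_closed.

HB.instance Definition _ := SubChoice.on (perp_space S).
HB.instance Definition _ := [SubChoice_isSubLmodule of perp_space S by <:].

Definition perp_inner (x y : perp_space S) : R[i] := '[val x, val y].

Lemma perp_inner_linearl y :
  GRing.linear_for *%R (fun x : perp_space S => perp_inner x y).
Proof. by move=> a x z; rewrite /perp_inner GRing.valD GRing.valZ linearDl linearZl_LR. Qed.

Lemma perp_inner_linearr x :
  GRing.linear_for (@Num.conj R[i] \; *%R) (perp_inner x).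
Proof. by move=> a y z; rewrite /perp_inner GRing.valD GRing.valZ linearDr linearZr_LR. Qed.

HB.instance Definition _ := @bilinear_isBilinear.Build R[i]
  (perp_space S) (perp_space S) R[i] *%R (@Num.conj R[i] \; *%R) perp_inner
  (perp_inner_linearl, perp_inner_linearr).

Lemma perp_inner_herm (x y : perp_space S) :
  perp_inner x y = (-1) ^+ false * (perp_inner y x)^*.
Proof. by rewrite expr0 mul1r [LHS]innerC. Qed.

HB.instance Definition _ :=
  isHermitianSesquilinear.Build R[i] (perp_space S) false (@Num.conj R[i])
    perp_inner perp_inner_herm.

Lemma perp_inner_gt0 (x : perp_space S) : x != 0 -> 0 < perp_inner x x.
Proof. by move=> x0; rewrite dnorm_gt0. Qed.

HB.instance Definition _ :=
  isDotProduct.Build R[i] (perp_space S) perp_inner perp_inner_gt0.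

Definition perp_norm (x : perp_space S) : R[i] := `|val x|.

Lemma perp_norm_triangle x y : perp_norm (x + y) <= perp_norm x + perp_norm y.
Proof. by rewrite /perp_norm raddfD ler_normD. Qed.

Lemma perp_normZ a x : perp_norm (a *: x) = `|a| * perp_norm x.
Proof. by rewrite /perp_norm linearZ normrZ. Qed.

Lemma perp_norm_eq0 x : perp_norm x = 0 -> x = 0.
Proof. by move/normr0_eq0 => x0; apply/val_inj; rewrite x0 raddf0. Qed.

HB.instance Definition _ := @Lmodule_isNormed.Build R[i] (perp_space S)
  perp_norm perp_norm_triangle perp_normZ perp_norm_eq0.

Lemma perp_space_complete (F : set_system (perp_space S)) :
  ProperFilter F -> cauchy F -> cvg F.
Proof.
move=> FF cF.
have : cauchy ((val : perp_space S -> H) @ F).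
  apply/cauchy_ballP => e e0; have /cauchy_ballP/(_ e e0) := cF.
  case=> -[A B] /= [FA FB] AB.
  exists ((val : perp_space S -> H) @` A, (val : perp_space S -> H) @` B) => /=.
    by split; [apply: filterS FA|apply: filterS FB] => x; exists x.
  move=> [_ _] /= [[x Ax <-] [y By <-]].
  have := AB (x, y) (conj Ax By); rewrite -!ball_normE.
  by rewrite -[(x, y).1]/x -[(x, y).2]/y /ball_/= -[`|x - y|]/(perp_norm _).
move=> /cauchy_cvg/cvg_ex [l Fl].
have Fl_lt e : 0 < e -> \forall x \near F, `|l - val x| < e.
  by move=> e0; move/cvgrPdist_lt: Fl; apply.
have lS : perpb S l.
  rewrite /perpb inE => y Sy; apply/eqP; apply: contraT => ly0.
  have d0 : 0 < `|'[l, y]| / (`|y| + 1).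
    by rewrite divr_gt0 ?normr_gt0// ltr_wpDl.
  have [x xlt] := filter_ex (Fl_lt _ d0).
  have xy0 : '[val x, y] = 0 by have := valP x; rewrite /perpb inE; exact.
  have := CauchySchwarz (l - val x) y.
  rewrite -exprMn ler_pXn2r ?nnegrE ?mulr_ge0// linearBl /= xy0 subr0.
  move: xlt; rewrite ltr_pdivlMr ?ltr_wpDl// => xlt.
  move=> /le_lt_trans/(_ (le_lt_trans _ xlt)).
  by rewrite ltxx; apply; rewrite ler_wpM2l// lerDl.
apply/cvg_ex; exists (Sub l lS : perp_space S).
apply/cvgrPdist_lt => e /Fl_lt; apply: filterS => x.
by rewrite -[`|Sub l lS - x|]/(perp_norm _) /perp_norm GRing.valB SubK.
Qed.

HB.instance Definition _ :=
  Uniform_isComplete.Build (perp_space S) perp_space_complete.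

Lemma perp_inner_norm (x : perp_space S) : perp_inner x x = `|x| ^+ 2.
Proof. by rewrite /perp_inner inner_norm. Qed.

HB.instance Definition _ :=
  isHilbert.Build R (perp_space S) perp_inner_norm.

End PerpSpace.

Section Operators.
Context {R : realType} {H : hilbertType R}.
Implicit Types (T P Q A U : H -> H) (S : set H).

(* B(H) *)
Definition bounded_op : set (H -> H) :=
  [set T | linear T /\ exists M : R[i], forall x, `|T x| <= M * `|x|].

(* [adjoint T] is T^*; for T in B(H) it exists and is unique, and the default
   value [cst 0] is only used for other functions T. *)
Definition is_adjoint T T' := forall x y, '[T x, y] = '[x, T' y].
Definition adjoint T : H -> H :=
  xget (cst 0) [set T' | bounded_op T' /\ is_adjoint T T'].

Definition orth_proj : set (H -> H) :=
  [set P | [/\ bounded_op P, P \o P = P & adjoint P = P]].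

Definition unitary : set (H -> H) :=
  [set U | [/\ bounded_op U, adjoint U \o U = id & U \o adjoint U = id]].

Definition diff_proj : set (H -> H) :=
  [set A | exists P Q, [/\ orth_proj P, orth_proj Q & A = P \- Q]].

Definition nullspace T : set H := [set x | T x = 0].

(* { (P, Q) : P - Q = A } *)
Definition diff_proj_fiber A : set ((H -> H) * (H -> H)) :=
  [set PQ | [/\ orth_proj PQ.1, orth_proj PQ.2 & PQ.1 \- PQ.2 = A]].

Definition commutant A : set (H -> H) :=
  [set T | bounded_op T /\ T \o A = A \o T].

Definition unitary_commutant A : set (H -> H) := commutant A `&` unitary.

Definition conj_pair U (PQ : (H -> H) * (H -> H)) : (H -> H) * (H -> H) :=
  (U \o PQ.1 \o adjoint U, U \o PQ.2 \o adjoint U).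

Definition nongeneric A : set H :=
  [set x + y | x in nullspace A & y in nullspace (A \o A \- id)].

End Operators.

(* The product of the group G of operators is composition. *)
Definition is_action (T X : Type) (G : set (T -> T)) (D : set X)
    (act : (T -> T) -> X -> X) :=
  [/\ forall g x, G g -> D x -> D (act g x),
      forall x, D x -> act id x = x &
      forall g h x, G g -> G h -> D x -> act (g \o h) x = act g (act h x)].

Definition transitive_action (T X : Type) (G : set (T -> T)) (D : set X)
    (act : (T -> T) -> X -> X) :=
  [/\ is_action G D act, D !=set0 &
      forall x y, D x -> D y -> exists2 g, G g & act g x = y].

Section GenericPart.
Context {R : realType} {H : hilbertType R}.
Implicit Types (T P Q A : H -> H).

Lemma adjoint_self T : adjoint T = T -> is_adjoint T T.
Proof.
rewrite /adjoint; case: xgetP => [T' _ [_ TT']|_] eqT; first by rewrite -{2}eqT.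
by move=> x y; rewrite -eqT linear0l linear0r.
Qed.

Lemma diff_proj_self A : diff_proj A -> is_adjoint A A.
Proof.
move=> [P [Q [[_ _ /adjoint_self hP] [_ _ /adjoint_self hQ] ->]]] x y /=.
by rewrite linearBl linearBr /= hP hQ.
Qed.

Lemma diff_proj_linear A : diff_proj A -> linear A.
Proof.
move=> [P [Q [[[lP _] _ _] [[lQ _] _ _] ->]]] a x y /=.
by rewrite lP lQ scalerBr addrACA opprD.
Qed.

Lemma generic_invariant A x :
  diff_proj A -> perpb (nongeneric A) x -> perpb (nongeneric A) (A x).
Proof.
move=> hA; rewrite /perpb !inE => xN _ [y Ay] [z Az] <-.
have lA := diff_proj_linear hA.
have A0 : A 0 = 0 by have := lA (-1) 0 0; rewrite scaler0 addr0 scaleN1r addNr.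
have AD u v : A (u + v) = A u + A v by have := lA 1 u v; rewrite !scale1r.
rewrite (diff_proj_self hA) AD Ay add0r; apply: xN.
exists 0; first exact: A0.
exists (A z); last by rewrite add0r.
move: Az => /= /eqP; rewrite subr_eq0 => /eqP /= Az.
by rewrite /nullspace /= Az subrr.
Qed.

Definition generic_space A : hilbertType R := perp_space (nongeneric A).

Definition generic_part A (hA : diff_proj A) :
    generic_space A -> generic_space A :=
  fun x => exist _ (A (val x)) (generic_invariant hA (valP x)).

End GenericPart.

(* Main.v *)
(* Write a pair [(P, Q)] over the generic operator [A] through
   [B := P + Q - 1], so that [P = (1 + A + B) / 2], [A^2 + B^2 = 1] and
   [A B = - B A].  Given a second pair, with [B'], put [J := sgn A],
   [V := sgn B] and [V' := sgn B']; genericity makes [A], [B] and [B']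
   injective, so these are symmetries.  [V] and [V'] anticommute with [A] and
   [J], and [V B = V' B'] is the square root of [1 - A^2].  Hence
   [U := (1 + J) / 2 + V' V (1 - J) / 2] is a unitary commuting with [A] such
   that [U B = B' U], which is the required conjugation.

   The sign of an injective self-adjoint [T] with [1 - T^2 = K^2] is the strong
   limit of the Newton-Schulz iterates [X_n] of [T].  They are [T] times
   polynomials in [K^2] with nonnegative coefficients, which gives
   [|X_m x - X_n x|^2 <= |X_m x|^2 - |X_n x|^2 <= |x|^2] for [n <= m]. *)
From HB Require Import structures.
From mathcomp Require Import all_boot all_order all_algebra.
From mathcomp Require Import sesquilinear complex.
From mathcomp Require Import all_classical all_reals.
From mathcomp Require Import topology normedtype sequences.
From mathcomp Require Import ring.
Require Import Defs.

Set Implicit Arguments.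
Unset Strict Implicit.
Unset Printing Implicit Defensive.

Import Order.TTheory GRing.Theory Num.Theory.
Import numFieldNormedType.Exports.

Local Open Scope classical_set_scope.
Local Open Scope ring_scope.

(** * Polynomials of an operator *)
Section OperatorPolynomial.
Context {K : comNzRingType} {V : lmodType K}.
Implicit Types (C M : {linear V -> V}) (p q : {poly K}).

Definition opoly (C : V -> V) (p : {poly K}) (x : V) : V :=
  \sum_(i < size p) p`_i *: iter i C x.

Lemma opoly_widen C p n x : (size p <= n)%N ->
  opoly C p x = \sum_(i < n) p`_i *: iter i C x.
Proof.
move=> pn; rewrite /opoly (big_ord_widen n (fun i => p`_i *: iter i C x))//.
rewrite big_mkcond; apply: eq_bigr => i _; case: ltnP => // /(nth_default 0) ->.
by rewrite scale0r.
Qed.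

Lemma opolyD C p q x : opoly C (p + q) x = opoly C p x + opoly C q x.
Proof.
rewrite !(@opoly_widen C _ (maxn (size p) (size q))) ?leq_maxl ?leq_maxr//.
  by rewrite -big_split; apply: eq_bigr => i _; rewrite coefD scalerDl.
exact: size_polyD.
Qed.

Lemma opolyCM C c p x : opoly C (c%:P * p) x = c *: opoly C p x.
Proof.
rewrite (@opoly_widen C _ (size p)); last by rewrite mul_polyC size_scale_leq.
by rewrite scaler_sumr; apply: eq_bigr => i _; rewrite coefCM scalerA.
Qed.

Lemma opoly0 C x : opoly C 0 x = 0.
Proof. by rewrite /opoly size_poly0 big_ord0. Qed.

Lemma opoly1 C x : opoly C 1 x = x.
Proof. by rewrite /opoly size_poly1 big_ord1 coef1 scale1r. Qed.

Lemma opolyMX C p x : opoly C (p * 'X) x = opoly C p (C x).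
Proof.
rewrite (@opoly_widen C _ (size p).+1); last first.
  by have := size_polyMleq p 'X; rewrite size_polyX addn2.
rewrite big_ord_recl coefMX scale0r add0r.
by apply: eq_bigr => i _; rewrite coefMX /= -iterSr.
Qed.

Lemma opoly_comm C M p x : (forall y, M (C y) = C (M y)) ->
  opoly C p (M x) = M (opoly C p x).
Proof.
move=> MC; rewrite linear_sum; apply: eq_bigr => i _; rewrite linearZ_LR; congr (_ *: _).
by elim: (i : nat) => //= n ->; rewrite MC.
Qed.

Lemma opolyM C p q x : opoly C (p * q) x = opoly C p (opoly C q x).
Proof.
elim/poly_ind: p x => [|p c IH] x; first by rewrite mul0r !opoly0.
rewrite mulrDl !opolyD opolyCM -[c%:P]mulr1 opolyCM opoly1; congr (_ + _).
by rewrite mulrAC !opolyMX IH -opoly_comm.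
Qed.

Lemma opoly_linear C p : linear (opoly C p).
Proof.
move=> a x y; rewrite /opoly scaler_sumr -big_split; apply: eq_bigr => i _ /=.
rewrite [X in _ = X + _]scalerA mulrC -scalerA -scalerDr; congr (_ *: _).
by elim: (i : nat) => //= n ->; rewrite linearP.
Qed.

HB.instance Definition _ C p :=
  GRing.isLinear.Build K V V *:%R (opoly C p) (opoly_linear C p).

Lemma opolyN C p x : opoly C (- p) x = - opoly C p x.
Proof. by rewrite -mulN1r -polyCN opolyCM scaleN1r. Qed.

End OperatorPolynomial.

(** * Newton-Schulz polynomials for the sign *)

Section SignPolynomials.
Variable K : numFieldType.

(* Newton-Schulz iteration [y |-> y (3 - y^2) / 2] for the sign, written with
   [y = t * s] and [d = 1 - y^2], as polynomials in ['X = 1 - t^2]; it is in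
   this variable that all coefficients are nonnegative. *)
Fixpoint sgn_poly n : {poly K} * {poly K} :=
  if n is m.+1 then
    let: (s, d) := sgn_poly m in
    (s + 2^-1%:P * (s * d), 4^-1%:P * (d * d * (3 + d)))
  else (1, 'X).

Definition sgn_s n := (sgn_poly n).1.
Definition sgn_d n := (sgn_poly n).2.

Lemma sgn_sS n : sgn_s n.+1 = sgn_s n + 2^-1%:P * (sgn_s n * sgn_d n).
Proof. by rewrite /sgn_s /sgn_d /=; case: sgn_poly. Qed.

Lemma sgn_dS n : sgn_d n.+1 = 4^-1%:P * (sgn_d n * sgn_d n * (3 + sgn_d n)).
Proof. by rewrite /sgn_s /sgn_d /=; case: sgn_poly. Qed.

(** With [y = t * s] and [t^2 = 1 - 'X] this is [d = 1 - y^2]; it persists because [(1 - d) (1 + d /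
    2)^2 = 1 - d^2 (3 + d) / 4]. *)
Lemma sgn_sdE n : (1 - 'X) * (sgn_s n * sgn_s n) = 1 - sgn_d n.
Proof.
elim: n => [|n IH]; first by rewrite /sgn_s /sgn_d /= !mulr1.
rewrite sgn_sS sgn_dS; set s := sgn_s n; set d := sgn_d n.
have -> : (4^-1 : K)%:P = 2^-1%:P * 2^-1%:P.
  by rewrite -polyCM -invfM -natrM.
have h2 : (2^-1 : K)%:P *+ 2 = 1.
  by rewrite -polyCMn -[2^-1 *+ 2]mulr_natr mulVf ?pnatr_eq0.
set h := _%:P in h2 *.
have -> : (1 - 'X) * ((s + h * (s * d)) * (s + h * (s * d))) =
  (1 - 'X) * (s * s) * ((1 + h * d) * (1 + h * d)) by ring.
rewrite IH -/d.
(* [ring] sees [h] as a variable, so a multiple of [h *+ 2 - 1] is left over; [h2] makes it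
   vanish. *)
have -> : (1 - d) * ((1 + h * d) * (1 + h * d)) =
  1 - h * h * (d * d * (3 + d)) + (h *+ 2 - 1) * (d + h *+ 2 * (d * d)) by ring.
by rewrite h2 subrr mul0r addr0.
Qed.

Definition nneg_poly (p : {poly K}) := forall i, 0 <= p`_i.

Lemma nneg_poly0 : nneg_poly 0.
Proof. by move=> i; rewrite coef0. Qed.

Lemma nneg_polyC (c : K) : 0 <= c -> nneg_poly c%:P.
Proof. by move=> c0 i; rewrite coefC; case: eqP. Qed.

Lemma nneg_polyD p q : nneg_poly p -> nneg_poly q -> nneg_poly (p + q).
Proof. by move=> p0 q0 i; rewrite coefD addr_ge0. Qed.

Lemma nneg_polyM p q : nneg_poly p -> nneg_poly q -> nneg_poly (p * q).
Proof.
by move=> p0 q0 i; rewrite coefM sumr_ge0// => j _; rewrite mulr_ge0.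
Qed.

Lemma nneg_sgn_sd n : nneg_poly (sgn_s n) /\ nneg_poly (sgn_d n).
Proof.
elim: n => [|n [s0 d0]].
  split; first by apply: nneg_polyC.
  by move=> i; rewrite /sgn_d coefX ler0n.
rewrite sgn_sS sgn_dS -polyC_natr; split.
  apply: nneg_polyD => //; apply: nneg_polyM; last exact: nneg_polyM.
  by apply: nneg_polyC; rewrite invr_ge0.
apply: nneg_polyM; first by apply: nneg_polyC; rewrite invr_ge0.
apply: nneg_polyM; first exact: nneg_polyM.
by apply: nneg_polyD => //; exact: nneg_polyC.
Qed.

(** Each increment [s * d / 2] has nonnegative coefficients. *)
Lemma nneg_sgn_sB m n : (n <= m)%N -> nneg_poly (sgn_s m - sgn_s n).
Proof.
move=> /subnKC <-; elim: (m - n)%N => [|k IH].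
  by rewrite addn0 subrr; exact: nneg_poly0.
rewrite addnS sgn_sS addrAC; apply: nneg_polyD => //.
have [s0 d0] := nneg_sgn_sd (n + k).
apply: nneg_polyM; last exact: nneg_polyM.
by apply: nneg_polyC; rewrite invr_ge0.
Qed.

End SignPolynomials.

(** * Limits in a Hilbert space *)
Section InnerLimits.
Context {R : realType} {H : hilbertType R}.
Implicit Types (x y : H) (u : nat -> H) (f : H -> H).

Lemma linear_repr f : linear f -> exists g : {linear H -> H}, f = g.
Proof.
move=> lf; pose m := GRing.isLinear.Build R[i] H H *:%R f lf.
by exists (HB.pack_for {linear H -> H} f m).
Qed.

Lemma inner_extl x y : (forall z, '[x, z] = '[y, z]) -> x = y.
Proof.
move=> h; apply/eqP; rewrite -subr_eq0 -normr_eq0 -sqrf_eq0 -inner_norm.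
by rewrite linearBl /= h subrr.
Qed.

Lemma inner_extr x y : (forall z, '[z, x] = '[z, y]) -> x = y.
Proof. by move=> h; apply: inner_extl => z; rewrite innerC h -innerC. Qed.

Lemma inner_ge0C x y : 0 <= '[x, y] -> 0 <= '[y, x].
Proof. by move=> xy; rewrite innerC conjC_ge0. Qed.

Lemma CauchySchwarz_norm x y : `|'[x, y]| <= `|x| * `|y|.
Proof.
by rewrite -(@ler_pXn2r _ 2) ?nnegrE ?mulr_ge0// exprMn CauchySchwarz.
Qed.

(** The squared norms are nondecreasing and bounded, so they approach their supremum; their gaps
    bound the distances, which makes [u] Cauchy. *)
Lemma norm_le_cvg u (M : R[i]) :
    (forall n m, (n <= m)%N ->
      `|u m - u n| ^+ 2 <= `|u m| ^+ 2 - `|u n| ^+ 2) ->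
    (forall n, `|u n| <= M) ->
  exists l : H, u n @[n --> \oo] --> l.
Proof.
(* Suprema are taken in [R], through real parts, since [R[i]] is only partially ordered. *)
move=> umono uM; pose a n := complex.Re (`|u n| ^+ 2).
have aE n : (a n)%:C%C = `|u n| ^+ 2 by rewrite RRe_real// realX// normr_real.
have M0 : 0 <= M := le_trans (normr_ge0 _) (uM 0%N).
have supa : has_sup (range a).
  split; first by exists (a 0%N); exists 0%N.
  exists (complex.Re (M ^+ 2)) => _ [n _ <-].
  rewrite -lecR aE RRe_real ?realX ?ger0_real//.
  by rewrite ler_pXn2r ?nnegrE.
apply/cvg_ex; apply: cauchy_cvg; apply: cauchy_exP => e e0.
have eE : (complex.Re e)%:C%C = e by rewrite RRe_real// gtr0_real.
have [_ [N _ <-] aN] : exists2 b, range a b & sup (range a) - (complex.Re e) ^+ 2 < b.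
  by apply: sup_adherent => //; rewrite exprn_gt0// -ltcR eE.
exists (u N); exists N => // n /= Nn; rewrite -ball_normE /ball_ /=.
rewrite distrC -(@ltr_pXn2r _ 2) ?nnegrE// ?ltW//.
apply: le_lt_trans (umono _ _ Nn) _; rewrite -!aE -eE -rmorphB -rmorphXn /= ltcR.
rewrite ltrBlDr -ltrBlDl; apply: le_lt_trans aN; rewrite lerB//.
by apply: ub_le_sup; [case: supa|exists n].
Qed.

(** The error splits into [m - f n l] and [f n (l - u n)], and the common bound makes the second
    part small. *)
Lemma norm_bounded_cvg (f : nat -> {linear H -> H}) (M : R[i]) u (l m : H) :
    (forall n x, `|f n x| <= M * `|x|) ->
    u n @[n --> \oo] --> l -> f n l @[n --> \oo] --> m ->
  f n (u n) @[n --> \oo] --> m.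
Proof.
move=> fM ul fl.
(* [M] is any complex number here, so the error is divided by [|M| + 1], which is positive. *)
have M1 : 0 < `|M| + 1 by rewrite ltr_wpDl.
apply/cvgrPdist_lt => e e0.
have h1 : 0 < e / 2 / (`|M| + 1) by rewrite !divr_gt0.
have h2 : 0 < e / 2 by rewrite divr_gt0.
move/cvgrPdist_lt: ul => /(_ _ h1) ul; move/cvgrPdist_lt: fl => /(_ _ h2) fl.
apply: filterS2 ul fl => n ul fl.
have -> : m - f n (u n) = (m - f n l) + f n (l - u n).
  by rewrite linearB addrA subrK.
apply: le_lt_trans (ler_normD _ _) _; rewrite (splitr e) ltr_leD// ?ltW//.
move: ul; rewrite ltr_pdivlMr// mulrC; apply: le_lt_trans.
apply: le_trans (fM _ _) _.
have [->|x0] := eqVneq (l - u n) 0; first by rewrite normr0 !mulr0.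
have M0 : 0 <= M.
  have := le_trans (normr_ge0 _) (fM 0%N (l - u n)).
  by rewrite pmulr_lge0// normr_gt0.
by rewrite ler_wpM2r// ger0_norm// lerDl.
Qed.

Lemma cvg_norm_le u (l : H) (M : R[i]) :
  u n @[n --> \oo] --> l -> (forall n, `|u n| <= M) -> `|l| <= M.
Proof.
move=> ul uM; have M0 : 0 <= M := le_trans (normr_ge0 _) (uM 0%N).
have Mr : M \is Num.real by rewrite ger0_real.
rewrite real_leNgt ?normr_real//; apply/negP; rewrite -subr_gt0 => e0.
move/cvgrPdist_lt: ul => /(_ _ e0)/filter_ex [n].
suff h : `|l| - M <= `|l - u n| by move=> /lt_le_trans/(_ h); rewrite ltxx.
by rewrite lerBlDr -[in leLHS](subrK (u n) l) (le_trans (ler_normD _ _))// lerD2l.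
Qed.

Lemma cvg0_norm_ge_eq0 u x :
  u n @[n --> \oo] --> (0 : H) -> (forall n, `|x| <= `|u n|) -> x = 0.
Proof.
move=> u0 xu; apply/eqP; apply: contraT; rewrite -normr_gt0 => x0.
move/cvgrPdist_lt: u0 => /(_ _ x0)/filter_ex [n].
by rewrite sub0r normrN => /lt_le_trans/(_ (xu n)); rewrite ltxx.
Qed.

End InnerLimits.

(** * The sign of a self-adjoint operator *)
Section Sign.
Context {R : realType} {H : hilbertType R}.

(** The iterate [t * s] at [t = T], with [K \o K] in place of [1 - t^2]; keeping [K] as a parameter
    lets two operators with the same [K] be compared. *)
Definition sgn_seq (T K : {linear H -> H}) n (x : H) : H :=
  opoly (K \o K) (sgn_s _ n) (T x).

HB.instance Definition _ T K n :=
  GRing.Linear.copy (sgn_seq T K n) (opoly (K \o K) (sgn_s _ n) \o T).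

Section OneOperator.
Context (T K : {linear H -> H}).
Hypotheses (Tsym : is_adjoint T T) (Ksym : is_adjoint K K).
Hypothesis TK1 : forall x, T (T x) + K (K x) = x.

Let C : {linear H -> H} := K \o K.
Let X n : {linear H -> H} := sgn_seq T K n.

Let CE x : C x = x - T (T x).
Proof. by rewrite -[X in X - _]TK1 addrC addKr. Qed.

(** [C] is [1 - T^2], so the factor [e] enters squared; [e = 1] and [e = -1] cover commuting and
    anticommuting [M] at once. *)
Lemma comm_sq (M : {linear H -> H}) (e : R[i]) x : e * e = 1 ->
  (forall y, M (T y) = e *: T (M y)) -> M (C x) = C (M x).
Proof.
by move=> e1 MT; rewrite !CE linearB /= !MT [T (e *: _)]linearZ /= scalerA e1 scale1r.
Qed.

Let TC x : T (C x) = C (T x).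
Proof. by rewrite !CE linearB. Qed.

Let Csym x y : '[C x, y] = '[x, C y].
Proof. by rewrite /= !Ksym. Qed.

(** Powers of [C = K \o K] are positive: symmetry lowers the exponent by two, down to [|x|^2] and
    [|K x|^2]. *)
Lemma opoly_sq_ge0 p x : nneg_poly p -> 0 <= '[opoly C p x, x].
Proof.
move=> p0; rewrite linear_sumlz sumr_ge0 => // i _.
rewrite linearZl_LR /= mulr_ge0//; move: x.
elim/ltn_ind: (i : nat) => {i} -[|[|i]] IH x.
- by rewrite inner_norm exprn_ge0.
- by rewrite /= Ksym inner_norm exprn_ge0.
- by rewrite iterS iterSr Csym IH.
Qed.

Lemma opoly_sq_sym p x y : nneg_poly p ->
  '[opoly C p x, y] = '[x, opoly C p y].
Proof.
move=> p0; rewrite linear_sumlz linear_sumr; apply: eq_bigr => i _.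
rewrite linearZl_LR linearZr_LR /= geC0_conj//; congr (_ * _).
by move: x; elim: (i : nat) => // n IH x; rewrite iterSr IH iterS Csym.
Qed.

Lemma sgn_seq_sym n x y : '[X n x, y] = '[x, X n y].
Proof.
rewrite opoly_sq_sym ?Tsym; last by case: (@nneg_sgn_sd R[i] n).
by rewrite -(opoly_comm _ _ TC).
Qed.

Lemma sgn_seq_sq n x : X n (X n x) = x - opoly C (sgn_d _ n) x.
Proof.
rewrite /X /= /sgn_seq -/C -(opoly_comm _ _ TC) -!opolyM.
have -> : T (T x) = opoly C (1 - 'X) x.
  rewrite opolyD opolyN -[X in _ - opoly C X _]mul1r opolyMX !opoly1.
  by rewrite CE subKr.
by rewrite -opolyM mulrC sgn_sdE opolyD opolyN opoly1.
Qed.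

(** A form of the recursion free of polynomials, through which the limit can be taken. *)
Lemma sgn_seqS n x :
  X n.+1 x = X n x + 2^-1 *: (X n x - X n (X n (X n x))).
Proof.
rewrite (sgn_seq_sq n (X n x)) subKr /X /= /sgn_seq sgn_sS opolyD opolyCM.
by rewrite mulrC opolyM.
Qed.

(** The defect [|x|^2 - |X n x|^2] is the inner product of [x] with [opoly C (sgn_d _ n) x]. *)
Lemma sgn_seq_contraction n x : `|X n x| <= `|x|.
Proof.
rewrite -(@ler_pXn2r _ 2) ?nnegrE// -!inner_norm sgn_seq_sym sgn_seq_sq.
rewrite linearBr gerBl; apply: inner_ge0C; apply: opoly_sq_ge0.
by case: (@nneg_sgn_sd R[i] n).
Qed.

(** The two sides differ by twice the real part of ['[X m x - X n x, X n x]], which is nonnegative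
    because [sgn_s m - sgn_s n] and [sgn_s n] have nonnegative coefficients. *)
Lemma sgn_seq_dist n m x : (n <= m)%N ->
  `|X m x - X n x| ^+ 2 <= `|X m x| ^+ 2 - `|X n x| ^+ 2.
Proof.
move=> nm.
have d0 : 0 <= '[X m x - X n x, X n x].
  have sn := (@nneg_sgn_sd R[i] n).1.
  rewrite /X /= /sgn_seq -/C -opolyN -opolyD -opoly_sq_sym// -opolyM.
  by apply/opoly_sq_ge0/nneg_polyM => //; exact: nneg_sgn_sB.
have := addr_ge0 d0 (inner_ge0C d0); rewrite -!inner_norm => h.
rewrite -subr_ge0; apply: le_trans h _.
rewrite !(linearBl, linearBr) /=.
set a := '[_, _]; set b := '[_, _]; set c := '[_, _]; set d := '[_, _].
by rewrite le_eqVlt; apply/orP; left; apply/eqP; ring.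
Qed.

(** The iteration starts at [X 0 = T] and norms do not decrease along it; this later makes the limit
    injective. *)
Lemma sgn_seq_norm_ge n x : `|T x| <= `|X n x|.
Proof.
rewrite -(@ler_pXn2r _ 2) ?nnegrE// -subr_ge0.
have := @sgn_seq_dist 0 n x isT; rewrite /X /= {2 4}/sgn_seq opoly1.
by apply: le_trans; rewrite exprn_ge0.
Qed.

(** In the limit the recursion reads [J = J + (J - J^3) / 2], so [J^3 = J]; the lower bound
    [|T x| <= |X n x|] makes [J] injective, hence [J^2 = 1]. *)
Lemma sgn_exists : (forall x, T x = 0 -> x = 0) ->
  exists J : {linear H -> H},
    [/\ forall x, X n x @[n --> \oo] --> J x, forall x, `|J x| <= `|x|,
        forall x, J (J x) = x & is_adjoint J J].
Proof.
move=> T0.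
have /choice [J XJ] x : exists l : H, X n x @[n --> \oo] --> l.
  apply: (@norm_le_cvg _ _ _ `|x|) => [n m nm|n].
    exact: sgn_seq_dist.
  exact: sgn_seq_contraction.
have /linear_repr[J' JJ'] : linear J.
  move=> a x y; apply: norm_cvg_unique (XJ _) _.
  have -> : (fun n => X n (a *: x + y)) = (fun n => a *: X n x + X n y).
    by apply/funext => n; rewrite linearP.
  by apply: cvgD => //; exact: cvgZl_tmp.
move: J' JJ' XJ => {}J -> XJ; exists J.
have J1 x : `|J x| <= `|x|.
  by apply: cvg_norm_le (XJ x) _ => n; exact: sgn_seq_contraction.
have Xcvg (u : nat -> H) (l : H) : u n @[n --> \oo] --> l ->
    X n (u n) @[n --> \oo] --> J l.
  move=> ul; apply: (@norm_bounded_cvg _ _ _ 1 _ _ _ _ ul (XJ l)) => n x.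
  by rewrite mul1r sgn_seq_contraction.
have J0 x : J x = 0 -> x = 0.
  move=> Jx; apply/T0; apply: (@cvg0_norm_ge_eq0 _ _ (X ^~ x)) => [|n].
    by rewrite -Jx.
  exact: sgn_seq_norm_ge.
have J3 x : J x = J (J (J x)).
  have h : X n.+1 x @[n --> \oo] --> J x + 2^-1 *: (J x - J (J (J x))).
    under eq_fun do rewrite sgn_seqS.
    apply: cvgD => //; apply: cvgZl_tmp; apply: cvgB => //.
    by apply: (Xcvg); apply: (Xcvg).
  have /(norm_cvg_unique h)/eqP : X n.+1 x @[n --> \oo] --> J x.
    by rewrite (cvg_shiftS (X ^~ x)).
  rewrite -subr_eq0 addrAC subrr add0r scaler_eq0 invr_eq0 pnatr_eq0 /=.
  by rewrite subr_eq0 => /eqP.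
split=> // [x|x y].
  by apply/eqP; rewrite -subr_eq0; apply/eqP/J0; rewrite linearB /= -J3 subrr.
apply/eqP; rewrite -subr_eq0; apply: contraT; rewrite -normr_gt0.
set z := _ - _ => z0.
(* Each approximation error is at most [e] times a norm; the [+ 1] keeps the denominator positive
   and the final inequality strict. *)
have s0 : 0 < `|x| + `|y| + 1 by rewrite ltr_wpDl// addr_ge0.
have e0 : 0 < `|z| / (`|x| + `|y| + 1) by rewrite divr_gt0.
set e := _ / _ in e0.
have [n [hx hy]] : exists n, `|J x - X n x| < e /\ `|J y - X n y| < e.
  move/cvgrPdist_lt: (XJ x) => /(_ _ e0) hx.
  move/cvgrPdist_lt: (XJ y) => /(_ _ e0) hy.
  by have [n [? ?]] := filter_ex (filterI hx hy); exists n.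
have : `|z| < `|z|; last by rewrite ltxx.
have zE : z = '[J x - X n x, y] - '[x, J y - X n y].
  by rewrite linearBl linearBr /= sgn_seq_sym opprB addrA subrK.
apply: (@le_lt_trans _ _ (e * (`|x| + `|y|))).
  rewrite {1}zE (le_trans (ler_normB _ _))// mulrDr addrC lerD//.
    by rewrite (le_trans (CauchySchwarz_norm _ _))// mulrC ler_wpM2r// ltW.
  by rewrite (le_trans (CauchySchwarz_norm _ _))// ler_wpM2r// ltW.
by rewrite /e mulrAC ltr_pdivrMr// ltr_pM2l// ltrDl.
Qed.

(** [M] commutes with [C], so the relation holds for every iterate, and boundedness of [M] carries
    it to the limit. *)
Lemma sgn_comm (J M : {linear H -> H}) (e m : R[i]) :
    (forall x, X n x @[n --> \oo] --> J x) ->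
    (forall x, `|M x| <= m * `|x|) ->
    e * e = 1 -> (forall x, M (T x) = e *: T (M x)) ->
  forall x, M (J x) = e *: J (M x).
Proof.
move=> XJ Mm e1 MT x.
have MX n y : M (X n y) = e *: X n (M y).
  rewrite /X /= /sgn_seq -opoly_comm; last by move=> z; exact: comm_sq e1 MT.
  by rewrite MT linearZ.
have h1 : M (X n x) @[n --> \oo] --> M (J x).
  exact: (@norm_bounded_cvg _ _ (fun=> M) m _ _ _ (fun=> Mm) (XJ x) (cvg_cst _)).
apply: norm_cvg_unique h1 _.
have -> : (fun n => M (X n x)) = (fun n => e *: X n (M x)) by exact/funext.
exact: cvgZl_tmp.
Qed.

End OneOperator.

(* Both sides are the square root of [1 - K^2]. *)
Lemma sgn_mul_eq (T T' K J J' : {linear H -> H}) :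
    (forall x, T (T x) = T' (T' x)) ->
    (forall x, sgn_seq T K n x @[n --> \oo] --> J x) ->
    (forall x, sgn_seq T' K n x @[n --> \oo] --> J' x) ->
  forall x, J (T x) = J' (T' x).
Proof.
move=> TT XJ XJ' x; apply: norm_cvg_unique (XJ _) _.
by under eq_fun do rewrite /sgn_seq TT; exact: XJ'.
Qed.

End Sign.

(** * The intertwining unitary *)
Section Intertwining.
Context {R : realType} {H : hilbertType R}.

(** [|x|^2 = |T x|^2 + |K x|^2]; the factor [1] matches the form of bound that [sgn_comm]
    expects. *)
Lemma sq_sum1_contraction (T K : {linear H -> H}) :
    is_adjoint T T -> is_adjoint K K -> (forall x, T (T x) + K (K x) = x) ->
  forall x, `|T x| <= 1 * `|x|.
Proof.
move=> Ts Ks TK x; rewrite mul1r -(@ler_pXn2r _ 2) ?nnegrE// -!inner_norm.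
rewrite -[X in _ <= '[_, X]](TK x) linearDr /= -(Ts x (T x)) -(Ks x (K x)) lerDl inner_norm.
by rewrite exprn_ge0.
Qed.

(* Since [sgn A] commutes with [A] and anticommutes with [B] and [B'], on its
   two eigenspaces [U] may be taken to be [1] and [sgn B' * sgn B]. *)
Lemma anticommuting_intertwiner (A B B' : {linear H -> H}) :
    is_adjoint A A -> is_adjoint B B -> is_adjoint B' B' ->
    (forall x, A (B x) = - B (A x)) -> (forall x, A (B' x) = - B' (A x)) ->
    (forall x, A (A x) + B (B x) = x) -> (forall x, A (A x) + B' (B' x) = x) ->
    (forall x, A x = 0 -> x = 0) -> (forall x, A (A x) = x -> x = 0) ->
  exists U U' : {linear H -> H},
    [/\ is_adjoint U U', forall x, U (U' x) = x, forall x, U' (U x) = x,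
        forall x, U (A x) = A (U x) & forall x, U (B x) = B' (U x)].
Proof.
move=> As Bs Bs' AB AB' AB1 AB1' A0 A20.
have BA1 x : B (B x) + A (A x) = x by rewrite addrC.
have BA1' x : B' (B' x) + A (A x) = x by rewrite addrC.
have BB x : B (B x) = B' (B' x) by apply: (addIr (A (A x))); rewrite BA1 BA1'.
have B0 x : B x = 0 -> x = 0.
  by move=> Bx; apply: A20; have := AB1 x; rewrite Bx linear0 addr0.
have B0' x : B' x = 0 -> x = 0.
  by move=> Bx; apply: A20; have := AB1' x; rewrite Bx linear0 addr0.
have Ac := sq_sum1_contraction As Bs AB1.
have Bc := sq_sum1_contraction Bs As BA1.
have Bc' := sq_sum1_contraction Bs' As BA1'.
(* The sign of [A] is built with [K = B], those of [B] and [B'] both with [K = A], so that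
   [sgn_mul_eq] can compare them. *)
have [J [XJ J1 JJ Js]] := sgn_exists As Bs AB1 A0.
have [V [XV _ VV Vs]] := sgn_exists Bs As BA1 B0.
have [V' [XV' _ VV' Vs']] := sgn_exists Bs' As BA1' B0'.
have {}J1 x : `|J x| <= 1 * `|x| by rewrite mul1r.
have N1 : (-1) * (-1) = 1 :> R[i] by rewrite mulrNN mulr1.
have JA x : J (A x) = A (J x).
  by rewrite (sgn_comm AB1 XJ Ac (mulr1 1)) ?scale1r// => y; rewrite scale1r.
have JB x : J (B x) = - B (J x).
  rewrite (sgn_comm AB1 XJ Bc N1) ?scaleN1r ?opprK// => y.
  by rewrite scaleN1r AB opprK.
have JB' x : J (B' x) = - B' (J x).
  rewrite (sgn_comm AB1 XJ Bc' N1) ?scaleN1r ?opprK// => y.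
  by rewrite scaleN1r AB' opprK.
have VB x : B (V x) = V (B x).
  by rewrite (sgn_comm BA1 XV Bc (mulr1 1)) ?scale1r// => y; rewrite scale1r.
have VB' x : B' (V' x) = V' (B' x).
  by rewrite (sgn_comm BA1' XV' Bc' (mulr1 1)) ?scale1r// => y; rewrite scale1r.
have AV x : A (V x) = - V (A x).
  by rewrite (sgn_comm BA1 XV Ac N1) ?scaleN1r// => y; rewrite scaleN1r.
have AV' x : A (V' x) = - V' (A x).
  by rewrite (sgn_comm BA1' XV' Ac N1) ?scaleN1r// => y; rewrite scaleN1r.
have JV x : J (V x) = - V (J x).
  by rewrite (sgn_comm BA1 XV J1 N1) ?scaleN1r// => y; rewrite scaleN1r.
have JV' x : J (V' x) = - V' (J x).
  by rewrite (sgn_comm BA1' XV' J1 N1) ?scaleN1r// => y; rewrite scaleN1r.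
have VBV x : V (B x) = V' (B' x) := sgn_mul_eq BB XV XV' x.
pose h : R[i] := 2^-1.
have hh x : h *: x + h *: x = x.
  by rewrite -scalerDl -mulr2n -[h *+ 2]mulr_natr mulVf ?scale1r// pnatr_eq0.
have hr : h^* = h by rewrite conj_Creal// realV realn.
(* [E] and [F] are the projections onto the eigenspaces of [J] for [1] and [-1]. *)
pose E : {linear H -> H} := h \*: (idfun \+ J).
pose F : {linear H -> H} := h \*: (idfun \- J).
have EE' x : E x = h *: (x + J x) by [].
have FE' x : F x = h *: (x - J x) by [].
have EF1 x : E x + F x = x.
  by rewrite EE' FE' -scalerDr addrACA subrr addr0 scalerDr hh.
have JE x : J (E x) = E x by rewrite EE' linearZ linearD /= JJ addrC.
have JF x : J (F x) = - F x.
  by rewrite FE' linearZ linearB /= JJ -scalerN opprB.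
have EE x : E (E x) = E x by rewrite [LHS]EE' JE scalerDr hh.
have FF x : F (F x) = F x by rewrite [LHS]FE' JF opprK scalerDr hh.
have EF x : E (F x) = 0 by rewrite EE' JF subrr scaler0.
have FE x : F (E x) = 0 by rewrite FE' JE subrr scaler0.
have Es : is_adjoint E E.
  by move=> x y; rewrite linearZl_LR linearZr_LR linearDl linearDr /= Js hr.
have Fs : is_adjoint F F.
  by move=> x y; rewrite linearZl_LR linearZr_LR linearBl linearBr /= Js hr.
have antiE (M : {linear H -> H}) : (forall x, J (M x) = - M (J x)) ->
    (forall x, E (M x) = M (F x)) /\ (forall x, F (M x) = M (E x)).
  move=> JM; split=> x.
    by rewrite EE' FE' JM [in RHS]linearZ [in RHS]linearB.
  by rewrite EE' FE' JM opprK [in RHS]linearZ [in RHS]linearD.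
have [EV FV] := antiE _ JV; have [EV' FV'] := antiE _ JV'.
have [EB FB] := antiE _ JB.
have AE x : A (E x) = E (A x) by rewrite !EE' [in LHS]linearZ [in LHS]linearD JA.
have AF x : A (F x) = F (A x) by rewrite !FE' [in LHS]linearZ [in LHS]linearB JA.
clearbody E F.
pose U : {linear H -> H} := E \+ (V' \o V \o F).
pose U' : {linear H -> H} := E \+ (F \o V \o V').
have UE x : U x = E x + V' (V (F x)) by [].
have UE' x : U' x = E x + F (V (V' x)) by [].
clearbody U U'.
exists U, U'; split=> [x y|x|x|x|x].
- by rewrite UE UE' linearDl linearDr /= Es Vs' Vs Fs.
- rewrite UE UE' !linearD /= EE EF FE FF !linear0 add0r addr0.
  by rewrite FV VV EV' VV' EF1.
- rewrite UE' UE !linearD /= EE VV' VV FF !(EV', FV, EF, FE) !linear0.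
  by rewrite addr0 add0r EF1.
- by rewrite !UE linearD /= AV' AV AE AF linearN opprK.
(* On the range of [E], [V' V B = V' V' B' = B']; on the range of [F],
   [B' V' V = V' B' V = V B V = B V V = B]. *)
- by rewrite !UE linearD /= EB FB VBV VV' VB' -VBV VB VV addrC.
Qed.

End Intertwining.

(** * Projections and unitaries *)
Section OperatorTheory.
Context {R : realType} {H : hilbertType R}.
Implicit Types (T P Q A U : H -> H).

(** The bound in [bounded_op] may be any complex number; a nonzero vector forces it to be
    nonnegative, and on the zero space [0] serves. *)
Lemma bounded_op_bound T : bounded_op T ->
  exists2 M : R[i], 0 <= M & forall x, `|T x| <= M * `|x|.
Proof.
move=> [_ [M TM]].
have [[x x0]|all0] := pselect (exists x : H, x != 0).
  exists M => //; have := le_trans (normr_ge0 _) (TM x).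
  by rewrite pmulr_lge0// normr_gt0.
exists 0 => // x; suff -> : T x = 0 by rewrite normr0 mul0r.
by apply/eqP; apply: contraPT all0 => Tx0 []; exists (T x).
Qed.

Lemma bounded_op_comp T U : bounded_op T -> bounded_op U -> bounded_op (T \o U).
Proof.
move=> bT bU; have [M M0 TM] := bounded_op_bound bT.
have [N _ UN] := bounded_op_bound bU.
split; first by move=> a x y /=; rewrite bU.1 bT.1.
exists (M * N) => x; apply: le_trans (TM _) _.
by rewrite -mulrA ler_wpM2l.
Qed.

Lemma adjoint_eq T T' : bounded_op T' -> is_adjoint T T' -> adjoint T = T'.
Proof.
move=> bT' TT'; rewrite /adjoint; case: xgetP => [S _ [_ TS]|/(_ T')[]//].
by apply/funext => y; apply: inner_extr => x; rewrite -TS TT'.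
Qed.

Lemma orth_projP P : orth_proj P <->
  [/\ bounded_op P, P \o P = P & is_adjoint P P].
Proof.
split=> -[bP PP Ps]; split=> //; first exact: adjoint_self.
exact: adjoint_eq.
Qed.

(* If [U] had no adjoint, [adjoint U] would be [cst 0], which is inverse to a
   linear map only on the zero space, where it is an adjoint after all. *)
Lemma unitary_adjoint U : unitary U ->
  bounded_op (adjoint U) /\ is_adjoint U (adjoint U).
Proof.
rewrite /unitary /adjoint /=; case: xgetP => [//|_ [[lU _] _ U0]].
have U00 : U 0 = 0.
  by have := lU (-1) 0 0; rewrite scaler0 addr0 scaleN1r addNr.
have all0 (x : H) : x = 0 by have /(congr1 (@^~ x)) /= := U0; rewrite U00.
split=> [|x y]; last by rewrite (all0 x) (all0 (U 0)) !linear0l.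
split=> [a x y|]; first by rewrite scaler0 addr0.
by exists 0 => x; rewrite normr0 mul0r.
Qed.

Lemma conj_orth_proj U P : unitary U -> orth_proj P ->
  orth_proj (U \o P \o adjoint U).
Proof.
move=> hU /orth_projP [bP PP Ps].
have [bU' Us] := unitary_adjoint hU; case: hU => bU U'U _.
apply/orth_projP; split.
- by apply: bounded_op_comp => //; exact: bounded_op_comp.
- apply/funext => x /=.
  have /(congr1 (@^~ (P (adjoint U x)))) /= -> := U'U.
  by have /(congr1 (@^~ (adjoint U x))) /= -> := PP.
- by move=> x y /=; rewrite Us Ps [RHS]innerC Us -innerC.
Qed.

Lemma diff_proj_fiber_action A :
  is_action (unitary_commutant A) (diff_proj_fiber A) conj_pair.
Proof.
split=> [U [P Q] [[_ UA] hU] [/= hP hQ PQ]|[P Q] _|].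
- split=> /=; [exact: conj_orth_proj|exact: conj_orth_proj|].
  case: hU => -[lU _] _ UU'.
  apply/funext => x /=; set y := adjoint U x.
  have -> : U (P y) - U (Q y) = U (P y - Q y).
    by rewrite addrC -scaleN1r -lU scaleN1r addrC.
  have /(congr1 (@^~ y)) /= -> := PQ.
  have /(congr1 (@^~ y)) /= -> := UA.
  by have /(congr1 (@^~ x)) /= -> := UU'.
- have id_adj : adjoint (@id H) = id.
    by apply: adjoint_eq => //; split=> [//|]; exists 1 => x; rewrite mul1r.
  by rewrite /conj_pair id_adj.
- move=> U W [P Q] [_ hU] [_ hW] _.
  have [bU' Us] := unitary_adjoint hU; have [bW' Ws] := unitary_adjoint hW.
  rewrite /conj_pair (_ : adjoint (U \o W) = adjoint W \o adjoint U)//.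
  apply: adjoint_eq; first exact: bounded_op_comp.
  by move=> x y /=; rewrite Us Ws.
Qed.

Lemma linear_adjoint_unitary (U U' : {linear H -> H}) :
    is_adjoint U U' -> (forall x, U (U' x) = x) -> (forall x, U' (U x) = x) ->
  unitary U /\ adjoint U = U'.
Proof.
move=> UU' U1 U1'.
have isom x : `|U x| = `|x|.
  apply/eqP; rewrite -(@eqrXn2 _ 2)// -!inner_norm.
  by rewrite UU' U1'.
have bU : bounded_op U.
  by split; [move=> a x y; exact: linearP|exists 1 => x; rewrite mul1r isom].
have bU' : bounded_op U'.
  split; [move=> a x y; exact: linearP|exists 1 => x].
  by rewrite mul1r -isom U1.
have adjU : adjoint U = U' by exact: adjoint_eq.
by split=> //; split=> //; rewrite adjU; apply/funext => x /=.
Qed.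

Lemma diff_proj_fiber_linear A PQ : diff_proj_fiber A PQ ->
  exists P Q : {linear H -> H},
    [/\ PQ = (P : H -> H, Q : H -> H), forall x, P (P x) = P x,
        forall x, Q (Q x) = Q x, is_adjoint P P & is_adjoint Q Q].
Proof.
case: PQ => P Q [/= /orth_projP[[lP _] PP Ps] /orth_projP[[lQ _] QQ Qs] _].
have [P' eP] := linear_repr lP; have [Q' eQ] := linear_repr lQ; subst P Q.
exists P', Q'; split=> // x.
  by have /(congr1 (@^~ x)) := PP.
by have /(congr1 (@^~ x)) := QQ.
Qed.

Lemma diff_sum_proj (P Q : {linear H -> H}) :
    (forall x, P (P x) = P x) -> (forall x, Q (Q x) = Q x) ->
    is_adjoint P P -> is_adjoint Q Q ->
  let A x := P x - Q x in let B x := P x + Q x - x in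
  [/\ is_adjoint B B, forall x, A (B x) = - B (A x) &
      forall x, A (A x) + B (B x) = x].
Proof.
move=> PP QQ Ps Qs A B; split.
- by move=> x y; rewrite /B linearBl linearBr linearDl linearDr /= Ps Qs.
- move=> x; rewrite /A /B !(linearB, linearD) /= PP QQ.
  (* [ring] needs scalars, so the vector identity is tested against inner products. *)
  apply: inner_extl => z; rewrite !(linearBl, linearDl, linearNl) /=; ring.
- move=> x; rewrite /A /B !(linearB, linearD) /= PP QQ.
  apply: inner_extl => z; rewrite !(linearBl, linearDl, linearNl) /=; ring.
Qed.

End OperatorTheory.

(** * The generic part *)
Section Generic.
Context {R : realType}.

Lemma diff_proj_fiber_transitive (H : hilbertType R) (A : H -> H) :
    (forall x, A x = 0 -> x = 0) -> (forall x, A (A x) = x -> x = 0) ->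
  forall x y, diff_proj_fiber A x -> diff_proj_fiber A y ->
  exists2 U, unitary_commutant A U & conj_pair U x = y.
Proof.
move=> A0 A20 x y hx hy.
have [P [Q [eqx PP QQ Ps Qs]]] := diff_proj_fiber_linear hx.
have [P' [Q' [eqy PP' QQ' Ps' Qs']]] := diff_proj_fiber_linear hy.
case: hx => _ _; rewrite eqx /= => eA; case: hy => _ _; rewrite eqy /= => eA'.
pose L : {linear H -> H} := P \- Q.
pose B : {linear H -> H} := P \+ Q \- idfun.
pose B' : {linear H -> H} := P' \+ Q' \- idfun.
have AL : A = L by rewrite -eA.
have LE' z : L z = P' z - Q' z by rewrite -AL -eA'.
have [Bs LB LB1] := diff_sum_proj PP QQ Ps Qs.
have [Bs' LB' LB1'] := diff_sum_proj PP' QQ' Ps' Qs'.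
have Ls : is_adjoint L L by move=> u v; rewrite /= linearBl linearBr /= Ps Qs.
rewrite {}AL in A0 A20 eA eA' *.
have [||U [U' [UU' U1 U1' UL UB]]] :=
    @anticommuting_intertwiner _ _ L B B' Ls Bs Bs' LB _ LB1 _ A0 A20.
- by move=> z; rewrite !LE'; exact: LB'.
- by move=> z; rewrite !LE'; exact: LB1'.
have double (V : lmodType R[i]) (u v : V) : u + u = v + v -> u = v.
  move=> uv; apply: (@scalerI _ _ 2); first by rewrite pnatr_eq0.
  by rewrite !scaler_nat !mulr2n.
(* Twice [P] is [L + B + 1] and twice [P'] is [L + B' + 1], as both pairs have difference [L]. *)
have UP z : U (P z) = P' (U z).
  apply: double; rewrite -linearD.
  have -> : P z + P z = L z + B z + z.
    by apply: inner_extl => w; rewrite !(linearBl, linearDl, linearNl) /=; ring.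
  rewrite 2!linearD UL UB LE'.
  by apply: inner_extl => w; rewrite !(linearBl, linearDl, linearNl) /=; ring.
have UQ z : U (Q z) = Q' (U z).
  have -> : Q z = P z - L z by rewrite /= subKr.
  by rewrite linearB UP UL LE' subKr.
have [hU adjU] := linear_adjoint_unitary UU' U1 U1'.
exists U; first by split=> //; split; [case: hU|apply/funext => z; exact: UL].
rewrite /conj_pair adjU /=.
by congr (_, _); apply/funext => z /=; rewrite ?UP ?UQ U1.
Qed.

Lemma perp_stable (H : hilbertType R) (S : set H) (T : H -> H) x :
    is_adjoint T T -> (forall y, S y -> S (T y)) ->
  perpb S x -> perpb S (T x).
Proof.
by move=> Ts ST; rewrite /perpb !inE => xS y Sy; rewrite Ts xS//; exact: ST.
Qed.

Definition perp_restrict (H : hilbertType R) (S : set H) (T : H -> H)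
    (ST : forall x, perpb S x -> perpb S (T x)) : perp_space S -> perp_space S :=
  fun x => exist _ (T (val x)) (ST _ (valP x)).

Lemma orth_proj_restrict (H : hilbertType R) (S : set H) (P : H -> H)
    (SP : forall x, perpb S x -> perpb S (P x)) :
  orth_proj P -> orth_proj (perp_restrict SP).
Proof.
move=> /orth_projP [[lP [M PM]] PP Ps]; apply/orth_projP; split.
- split; first by move=> a x y; apply: val_inj; exact: lP.
  by exists M => x; exact: PM.
- apply/funext => x; apply: val_inj.
  by have /(congr1 (@^~ (val x))) := PP.
- by move=> x y; exact: Ps.
Qed.

(** Both sides reduce to [P x - P (Q (P x))]. *)
Lemma diff_proj_comm_sq (H : hilbertType R) (P Q : {linear H -> H}) x :
    (forall x, P (P x) = P x) -> (forall x, Q (Q x) = Q x) ->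
  let A y := P y - Q y in A (A (P x)) = P (A (A x)).
Proof.
move=> PP QQ A; rewrite /A !linearB /= !PP !QQ.
by apply: inner_extl => w; rewrite !(linearBl, linearDl, linearNl) /=; ring.
Qed.

(** On the null space of [P - Q] the vector [P u = Q u] is fixed by both projections; the null space
    of [(P - Q)^2 - 1] is stable because [P] and [Q] commute with [(P - Q)^2]. *)
Lemma nongeneric_stable (H : hilbertType R) (P Q : {linear H -> H}) y :
    (forall x, P (P x) = P x) -> (forall x, Q (Q x) = Q x) ->
  nongeneric (P \- Q) y -> nongeneric (P \- Q) (P y) /\ nongeneric (P \- Q) (Q y).
Proof.
move=> PP QQ [u /= /eqP]; rewrite subr_eq0 => /eqP PQu [v].
rewrite /nullspace /= => Av <-.
have sqP x := @diff_proj_comm_sq _ P Q x PP QQ.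
have sqQ x := @diff_proj_comm_sq _ Q P x QQ PP.
(* Swapping [P] and [Q] changes the sign of the difference and preserves its square. *)
have opp2 x : Q (Q x - P x) - P (Q x - P x) = P (P x - Q x) - Q (P x - Q x).
  by rewrite -[Q x - P x]opprB !linearN addrC opprK.
rewrite !linearD /=; split.
  exists (P u); first by rewrite /nullspace /= PP {2}PQu QQ PQu subrr.
  exists (P v) => //; rewrite /nullspace /=.
  have := sqP v; rewrite /= => ->.
  by rewrite -linearB Av linear0.
exists (Q u); first by rewrite /nullspace /= QQ -{1}PQu PP PQu subrr.
exists (Q v) => //; rewrite /nullspace /=.
have := sqQ v; rewrite /= !opp2 => ->.
by rewrite -linearB Av linear0.
Qed.

Lemma perp_self (H : hilbertType R) (S : set H) (x : perp_space S) :
  S (val x) -> x = 0.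
Proof.
move=> Sx; apply: val_inj => /=; apply/eqP.
rewrite -normr_eq0 -sqrf_eq0 -inner_norm; apply/eqP.
by have := valP x; rewrite /perpb inE; exact.
Qed.

Lemma generic_part_inj (H : hilbertType R) (A : H -> H) (hA : diff_proj A) x :
  generic_part hA x = 0 -> x = 0.
Proof.
move=> /(congr1 val) /= Ax; apply: perp_self.
have [L LE] := linear_repr (diff_proj_linear hA).
exists (val x) => //; exists 0; last by rewrite addr0.
by rewrite /nullspace LE /= !linear0 addr0.
Qed.

Lemma generic_part_sq_inj (H : hilbertType R) (A : H -> H) (hA : diff_proj A) x :
  generic_part hA (generic_part hA x) = x -> x = 0.
Proof.
move=> /(congr1 val) /= Ax; apply: perp_self.
have [L LE] := linear_repr (diff_proj_linear hA).
exists 0; first by rewrite /nullspace LE /= linear0.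
by exists (val x); rewrite ?add0r// /nullspace /= Ax subrr.
Qed.

(** A pair for [A] preserves [nongeneric A], hence by self-adjointness its orthogonal complement,
    and restricts there. *)
Lemma generic_fiber_nonempty (H : hilbertType R) (A : H -> H) (hA : diff_proj A) :
  diff_proj_fiber (generic_part hA) !=set0.
Proof.
have [P0 [Q0 [hP hQ eA]]] := hA.
have hPQ : diff_proj_fiber A (P0, Q0) by split.
have [P [Q [[eP eQ] PP QQ Ps Qs]]] := diff_proj_fiber_linear hPQ.
rewrite {}eP {}eQ in hP hQ eA {hPQ}.
have SP x := @perp_stable _ (nongeneric A) P x Ps.
have SQ x := @perp_stable _ (nongeneric A) Q x Qs.
have {}SP x : perpb (nongeneric A) x -> perpb (nongeneric A) (P x).
  by apply: SP => y; rewrite eA => /(nongeneric_stable PP QQ)[].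
have {}SQ x : perpb (nongeneric A) x -> perpb (nongeneric A) (Q x).
  by apply: SQ => y; rewrite eA => /(nongeneric_stable PP QQ)[].
exists (perp_restrict SP, perp_restrict SQ); split=> /=.
- exact: orth_proj_restrict.
- exact: orth_proj_restrict.
- by apply/funext => x; apply: val_inj; have /= -> := congr1 (@^~ (val x)) eA.
Qed.

End Generic.

Theorem theorem3p1 (R : realType) (H : hilbertType R) (A : H -> H)
    (hA : diff_proj A) :
  transitive_action (unitary_commutant (generic_part hA))
    (diff_proj_fiber (generic_part hA)) conj_pair.
Proof.
split; first exact: diff_proj_fiber_action.
  exact: generic_fiber_nonempty.
apply: diff_proj_fiber_transitive => x.
  exact: generic_part_inj.
exact: generic_part_sq_inj.
Qed.
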